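(* Let $n\ge 1$ and let $v=p_1p_2\cdots p_n$, where $p_1,p_2,\dots,p_n$ are odd integers (not necessarily prime or distinct) with $p_i>1$ for $1\le i\le n$. Then there exists a $(v,2;2^{n},\frac{v-1}{2};2^{n-1},2^{n-1})$-GSEDF (in some abelian group of order $v$).
   Context: Let $G$ be a finite abelian group of order $v$, written additively with identity $0$. For disjoint subsets $A,B\subseteq G$, let $\Delta(A,B)$ be the multiset $\{x-y : x\in A, y\in B\}$. For positive integers $k_1,k_2,\lambda_1,\lambda_2$, a $(v,2;k_1,k_2;\lambda_1,\lambda_2)$-generalized strong external difference family (GSEDF) in $G$ is a pair $\{D_1,D_2\}$ of disjoint nonempty subsets of $G$ with $|D_1|=k_1$, $|D_2|=k_2$ such that $\Delta(D_1,D_2)$ contains every element of $G\setminus\{0\}$ exactly $\lambda_1$ times and $\Delta(D_2,D_1)$ contains every element of $G\setminus\{0\}$ exactly $\lambda_2$ times. *)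

(* Defs.v *)
From HB Require Import structures.
From mathcomp Require Import all_boot all_order all_algebra.

Set Implicit Arguments.
Unset Strict Implicit.
Unset Printing Implicit Defensive.

Import GRing.Theory.

(* A multiset is represented by a sequence: the multiplicity of g is
   count_mem g. *)
Definition Delta (G : finZmodType) (A B : {set G}) : seq G :=
  [seq (x - y)%R | x <- enum A, y <- enum B].

(* The pair is ordered only to match D1 with (k1, l1) and D2 with (k2, l2). *)
Record gsedf (v k1 k2 l1 l2 : nat) (G : finZmodType) (D1 D2 : {set G}) :
    Prop := Gsedf {
  gsedf_order : #|G| = v;
  gsedf_k1_gt0 : 0 < k1;
  gsedf_k2_gt0 : 0 < k2;
  gsedf_l1_gt0 : 0 < l1;
  gsedf_l2_gt0 : 0 < l2;
  gsedf_D1_neq0 : D1 != set0;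
  gsedf_D2_neq0 : D2 != set0;
  gsedf_disjoint : [disjoint D1 & D2];
  gsedf_card1 : #|D1| = k1;
  gsedf_card2 : #|D2| = k2;
  gsedf_diff12 : forall g : G, g != 0%R -> count_mem g (Delta D1 D2) = l1;
  gsedf_diff21 : forall g : G, g != 0%R -> count_mem g (Delta D2 D1) = l2
}.

(* Main.v *)
Require Import Defs.
From HB Require Import structures.
From mathcomp Require Import all_boot all_order all_algebra.
From mathcomp Require Import zify.

Set Implicit Arguments.
Unset Strict Implicit.
Unset Printing Implicit Defensive.

Import GRing.Theory.

(** Let [s_D = 1 - 2 D] be the function equal to -1 on [D] and to 1 elsewhere.
    In the group ring with unit [e], [A D^(-1) = (|A|/2) (G - e)] is equivalent
    to [A s_D^(-1) = |A| e], and the latter condition is multiplicative over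
    direct products of groups: the sets [A] are multiplied, and so are the
    signs, that is, the sets [D] are combined by exclusive or of coordinates.
    In the cyclic group of odd order [p] it holds for [A = {0, 1}] and
    [D = {2, 4, .., p - 1}]. *)

Definition sign_inverse (G : finZmodType) (A D : {set G}) : Prop :=
  forall g : G,
    (\sum_(a in A) (-1) ^+ (a - g \in D)%R = (#|A| * (g == 0%R))%N%:Z :> int)%R.

Lemma count_Delta (G : finZmodType) (A B : {set G}) (g : G) :
  count_mem g (Delta A B) = \sum_(x in A) (x - g \in B)%R.
Proof.
rewrite -sum1_count big_mkcond big_allpairs_dep -big_enum /=.
apply: eq_bigr => x _; rewrite big_enum /= -big_mkcondr /=.
case: (boolP (x - g \in B)%R) => xgB.
  rewrite (bigD1 (x - g)%R) ?xgB ?subKr //= big1 // => y /andP[/andP[_ /eqP <-]].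
  by rewrite subKr eqxx.
rewrite big1 // => y /andP[yB /eqP eg]; case/negP: xgB.
by rewrite -eg subKr.
Qed.

Lemma count_DeltaN (G : finZmodType) (A B : {set G}) (g : G) :
  count_mem g (Delta B A) = count_mem (- g)%R (Delta A B).
Proof.
rewrite -!sum1_count big_mkcond [RHS]big_mkcond !big_allpairs_dep.
rewrite exchange_big /=.
apply: eq_bigr => x _; apply: eq_bigr => y _.
by rewrite /= -(opprB y x) eqr_opp.
Qed.

Lemma sum_sign (I : finType) (A : {set I}) (P : pred I) :
  (\sum_(a in A) (-1) ^+ P a = #|A|%:Z - (2 * \sum_(a in A) P a)%N%:Z)%R.
Proof.
rewrite -sum1_card big_distrr /= !(big_morph Posz PoszD (erefl _)) -sumrB.
by apply: eq_bigr => a _; case: (P a).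
Qed.

(** Away from 0 the signs cancel, so [a - g] lies in [D] for exactly half of the [a] in [A]. *)
Lemma sign_inverse_count (G : finZmodType) (A D : {set G}) (g : G) :
  sign_inverse A D -> g != 0%R -> 2 * count_mem g (Delta A D) = #|A|.
Proof.
move=> /(_ g) + /negPf g0; rewrite (sum_sign A (fun a => a - g \in D)%R) g0.
by rewrite count_Delta; lia.
Qed.

(** Double counting: summed over all [g], each [a] contributes [#|G| - 2 * #|D|], while only [g = 0]
    contributes on the right; then [#|A|] cancels. *)
Lemma sign_inverse_card (G : finZmodType) (A D : {set G}) :
  sign_inverse A D -> 0 < #|A| -> 2 * #|D| + 1 = #|G|.
Proof.
move=> AD A0.
have sumD : (\sum_(g : G) \sum_(a in A) (-1) ^+ (a - g \in D)%R
    = #|A|%:Z * (#|G|%:Z - (2 * #|D|)%N%:Z) :> int)%R.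
  have -> : #|D| = \sum_(x in [set: G]) (x \in D).
    rewrite -sum1_card big_mkcond; apply: eq_big => x; first by rewrite inE.
    by case: (x \in D).
  rewrite exchange_big /= -cardsT -(sum_sign [set: G] (mem D)).
  rewrite -[(#|A|%:Z)%R]natz -sumr_const mulr_suml; apply: eq_bigr => a _.
  (* The substitution of [a - x] for [g] removes the dependence on [a]. *)
  rewrite mul1r (reindex_inj (inj_comp (addrI a) oppr_inj)).
  by apply: eq_big => x; rewrite /= ?inE // subKr.
have : (\sum_(g : G) \sum_(a in A) (-1) ^+ (a - g \in D)%R = #|A|%:Z :> int)%R.
  rewrite (eq_bigr _ (fun g _ => AD g)) (bigD1 0%R) //= eqxx muln1.
  by rewrite big1 ?addr0 // => g /negPf->; rewrite muln0.
rewrite sumD; nia.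
Qed.

(** Lets [G * H] be inferred as a [finZmodType]. *)
HB.instance Definition _ (G H : finZmodType) := GRing.Zmodule.on (G * H)%type.

Lemma sign_inverse_prod (G H : finZmodType) (A D : {set G}) (B E : {set H}) :
  sign_inverse A D -> sign_inverse B E ->
  sign_inverse (setX A B) [set x | (x.1 \in D) (+) (x.2 \in E)].
Proof.
move=> AD BE [g h]; rewrite cardsX.
transitivity (\sum_(a in A) \sum_(b in B)
    (-1) ^+ (a - g \in D)%R * (-1) ^+ (b - h \in E)%R : int)%R.
  rewrite pair_big /=; apply: eq_big => -[a b]; rewrite !inE //= => _.
  by rewrite signr_addb.
under eq_bigr do rewrite -mulr_sumr BE.
by rewrite -mulr_suml AD -PoszM xpair_eqE mulnACA mulnb.
Qed.

(** The sum compares the signs at the cyclic neighbours [- g] and [1 - g]. Around the cycle the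
    signs are +, +, -, +, -, ..., +, -, the last being - because [p - 1] is even and nonzero. Hence
    neighbours cancel, also from [p - 1] back to 0, except for the pair 0, 1 at [g = 0]. *)
Lemma sign_inverse_Zp (p : nat) : odd p -> 1 < p ->
  exists (G : finZmodType) (A D : {set G}),
    [/\ #|G| = p, #|A| = 2, [disjoint A & D] & sign_inverse A D].
Proof.
case: p => [|[|m]] // /= /negPn m_odd _.
exists 'I_m.+2, [set 0; 1]%R, [set x : 'I_m.+2 | (x != 0 :> nat) && ~~ odd x].
have n01 : (0 : 'I_m.+2)%R != 1%R by [].
split; rewrite ?card_ord ?cards2 //.
  rewrite disjoint_sym disjoint_subset; apply/subsetP => x; rewrite !inE.
  by rewrite negb_or -!val_eqE /= => /andP[-> ]; case: (val x) => [|[|]].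
move=> g; rewrite big_setU1 ?inE //= big_set1 !inE cards2 n01.
have N0g : val (0 - g)%R = if g == 0 :> nat then 0 else m.+2 - g.
  rewrite /= add0n modn_mod.
  case: eqP => [->|g0]; first by rewrite subn0 modnn.
  by rewrite modn_small //; lia.
(* Here [m.+3] is [p + 1]; [g = 1] is separate since [p] reduces to 0. *)
have N1g : val (1 - g)%R
    = if g == 0 :> nat then 1 else if g == 1 :> nat then 0 else m.+3 - g.
  rewrite /= modnDmr; have := ltn_ord g.
  case: eqP => [->|g0 g_lt]; first by rewrite subn0 modnDr.
  case: eqP => [->|g1]; first by rewrite subn1 add1n modnn.
  by rewrite (@modn_small 1) // modn_small; lia.
rewrite -[LHS]/((-1) ^+ ((val (0 - g) != 0%N) && ~~ odd (val (0 - g)))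
  + (-1) ^+ ((val (1 - g) != 0%N) && ~~ odd (val (1 - g))))%R.
rewrite [g == _](_ : _ = (g == 0 :> nat)) // N0g N1g.
move: (ltn_ord g); case: (nat_of_ord g) => [|[|k]] k_lt //.
  by rewrite subn1 /= m_odd.
(* No wraparound remains: both representatives are nonzero and consecutive, hence of opposite
   parity. *)
have -> : m.+3 - k.+2 = (m.+2 - k.+2).+1 by lia.
rewrite /= -lt0n subn_gt0 k_lt /= negbK.
by case: (odd _).
Qed.

Lemma sign_inverse_exists (n : nat) (p : 'I_n -> nat) :
  (forall i, odd (p i)) -> (forall i, 1 < p i) ->
  exists (G : finZmodType) (A D : {set G}),
    [/\ #|G| = \prod_(i < n) p i, #|A| = 2 ^ n, [disjoint A & D]
      & sign_inverse A D].
Proof.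
elim: n p => [|n IHn] p p_odd p_gt1.
  (* The empty product is the trivial group, where the sign is constantly 1. *)
  exists 'I_1, [set: 'I_1], set0; split; rewrite ?big_ord0 ?cardsT ?card_ord //.
    by rewrite disjoint_sym disjoints_subset sub0set.
  move=> g; rewrite (ord1 g) eqxx cardsT card_ord.
  by rewrite (bigD1 0%R) ?inE //= big1 ?inE // => i; rewrite ord1 eqxx andbF.
have [G [A [D [cG cA dA AD]]]] := IHn _ (fun i => p_odd (lift ord0 i))
  (fun i => p_gt1 (lift ord0 i)).
have [H [B [E [cH cB dB BE]]]] := sign_inverse_Zp (p_odd ord0) (p_gt1 ord0).
exists (H * G)%type, (setX B A), [set x | (x.1 \in E) (+) (x.2 \in D)].
split; last exact: sign_inverse_prod.
- by rewrite card_prod cG cH big_ord_recl.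
- by rewrite cardsX cA cB expnS.
apply/pred0P => -[x y]; rewrite !inE /=.
case: (boolP (x \in B)) => //= xB; case: (boolP (y \in A)) => //= yA.
by rewrite (disjointFr dB xB) (disjointFr dA yA).
Qed.

Theorem theorem4p7 (n v : nat) (p : 'I_n -> nat)
    (hn : 1 <= n)
    (hodd : forall i : 'I_n, odd (p i))
    (hp : forall i : 'I_n, 1 < p i)
    (hv : v = \prod_(i < n) p i) :
  exists (G : finZmodType) (D1 D2 : {set G}),
    gsedf v (2 ^ n) ((v - 1) %/ 2) (2 ^ (n - 1)) (2 ^ (n - 1)) D1 D2.
Proof.
have [G [A [D [cG cA dAD AD]]]] := sign_inverse_exists hodd hp.
have A0 : 0 < #|A| by rewrite cA expn_gt0.
have cD := sign_inverse_card AD A0.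
have cDv : #|D| = (v - 1) %/ 2 by rewrite hv -cG -cD; lia.
have countA g : g != 0%R -> count_mem g (Delta A D) = 2 ^ (n - 1).
  move=> /(sign_inverse_count AD); rewrite cA.
  by rewrite -{1}(subnK hn) addn1 expnS => /eqP; rewrite eqn_pmul2l // => /eqP.
(* [2 * #|D| + 1 = #|G| >= #|A| = 2 ^ n > n >= 1]. *)
have D0 : 0 < #|D|.
  have := max_card (mem A); rewrite cA -cD.
  have := ltn_expl n (isT : 1 < 2).
  by lia.
exists G, A, D; split; rewrite -?cDv -?card_gt0 ?expn_gt0 //.
- by rewrite cG hv.
(* Reversing the differences negates them, and [- g] is again nonzero. *)
- by move=> g g0; rewrite count_DeltaN countA // oppr_eq0.
Qed.
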